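(* Suppose that $g(x,\xi)$ is a function $g:\mathcal X\times\Xi\to\mathbb R_-\cup\{M\}$, where $M>0$ is a positive constant. Then the optimal value $v^A$ of ALSO-X coincides with the optimal value $v^*$ of the chance constrained program $v^*=\min_{x\in\mathcal X}\{c^\top x:\ \mathbb P\{g(x,\tilde\xi)\le0\}\ge1-\varepsilon\}$.
   Context: Setting. $\tilde\xi$ is a random vector on a probability space with law $\mathbb P$ (arbitrary) and support $\Xi\subseteq\mathbb R^m$; $\varepsilon\in(0,1)$; $c\in\mathbb R^n$; $\mathcal X\subseteq\mathbb R^n$ (not necessarily convex). $\mathbb R_-=(-\infty,0]$. The chance constrained program is assumed feasible with an optimal solution, and $g(x,\cdot)$ is measurable for each $x$. Constraints on random quantities hold almost surely. ALSO-X. For $t\in\mathbb R$, the hinge-loss approximation is $\min_{x\in\mathcal X,\,s(\cdot)\ge0}\{\mathbb E[s(\tilde\xi)]:\ g(x,\tilde\xi)\le s(\tilde\xi),\ c^\top x\le t\}$, with $s:\Xi\to\mathbb R$ measurable. ALSO-X is $$v^A=\min_t\{t:\ (x^*,s^*(\cdot))\text{ optimal for the hinge-loss approximation at }t,\ \mathbb P\{s^*(\tilde\xi)=0\}\ge1-\varepsilon\}.$$ Convention: $t$ is feasible if $\{x\in\mathcal X:c^\top x\le t\}\ne\emptyset$ and every optimal solution of the hinge-loss approximation satisfies the probability condition; the hinge-loss optimum is taken to be attained whenever its feasible set is nonempty. *)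

(* Defs.v *)
From HB Require Import structures.
From mathcomp Require Import all_boot all_order all_algebra.
From mathcomp Require Import all_classical all_reals all_analysis.
Import Order.TTheory GRing.Theory Num.Theory.
Import numFieldNormedType.Exports.

Set Implicit Arguments.
Unset Strict Implicit.
Unset Printing Implicit Defensive.

Local Open Scope classical_set_scope.
Local Open Scope ring_scope.

(* R^m as a measurable space, with the Borel sigma-algebra. *)
Notation borel_cV R m := (g_sigma_algebraType (@open 'cV[R]_m)).

Definition is_minimum (R : realType) (A : set R) (v : R) : Prop :=
  A v /\ lbound A v.

Definition dotp (R : realType) (n : nat) (c x : 'cV[R]_n) : R :=
  (c^T *m x) ord0 ord0.

Section ChanceConstrained.
Context {R : realType} {n m : nat} {d : measure_display}
  {Omega : measurableType d}.
Variables (P : probability Omega R) (xi : {RV P >-> borel_cV R m}).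

Definition supp : set (borel_cV R m) :=
  [set z | forall U : set 'cV[R]_m, open U -> U z ->
             (0 < P (xi @^-1` U))%E].

(* Functions on the support are represented by total functions on R^m whose
   values outside of the support are irrelevant. Hence every event,
   expectation and almost sure constraint below is restricted to the event
   that xi lies in its support, which has probability one. *)
Definition prob_supp (A : set (borel_cV R m)) : \bar R :=
  P [set w | supp (xi w) /\ A (xi w)].

Definition expect_supp (s : borel_cV R m -> R) : \bar R :=
  (\int[P]_(w in xi @^-1` supp) (s (xi w))%:E)%E.

Variables (X : set 'cV[R]_n) (g : 'cV[R]_n -> borel_cV R m -> R)
  (c : 'cV[R]_n) (eps : R).

Definition ccp_feasible (x : 'cV[R]_n) : Prop :=
  X x /\ ((1 - eps)%:E <= prob_supp [set z | (g x z <= 0)%R])%E.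

Definition is_ccp_value (v : R) : Prop :=
  is_minimum [set dotp c x | x in ccp_feasible] v.

Definition hinge_feasible (t : R) (x : 'cV[R]_n) (s : borel_cV R m -> R) :
    Prop :=
  [/\ X x,
      measurable_fun supp s,
      forall z, supp z -> 0 <= s z,
      {ae P, forall w, supp (xi w) -> g x (xi w) <= s (xi w)} &
      dotp c x <= t].

Definition hinge_optimal (t : R) (x : 'cV[R]_n) (s : borel_cV R m -> R) :
    Prop :=
  hinge_feasible t x s /\
  forall x' s', hinge_feasible t x' s' ->
    (expect_supp s <= expect_supp s')%E.

Definition hinge_attained : Prop :=
  forall t, (exists x s, hinge_feasible t x s) ->
            exists x s, hinge_optimal t x s.

Definition alsox_feasible (t : R) : Prop :=
  (exists x, X x /\ dotp c x <= t) /\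
  forall x s, hinge_optimal t x s ->
    ((1 - eps)%:E <= prob_supp [set z | s z = 0%R])%E.

Definition is_alsox_value (v : R) : Prop := is_minimum alsox_feasible v.

End ChanceConstrained.

(* Main.v *)
(** When [g x] only takes values in [(-oo, 0]] and [M], the cheapest hinge loss
    for a fixed [x] is [M * 1_{g x > 0}], whose expectation is [M] times the
    violation probability. Minimising the hinge loss is thus minimising the
    violation probability over [{x in X | c^T x <= t}], so that a threshold [t]
    passes the ALSO-X test exactly when some chance-constraint-feasible [x] has
    [c^T x <= t]. *)
Require Import Defs.
From HB Require Import structures.
From mathcomp Require Import all_boot all_order all_algebra.
From mathcomp Require Import all_classical all_reals all_analysis.
From mathcomp Require Import measurable_realfun.
Import Order.TTheory GRing.Theory Num.Theory.
Import numFieldNormedType.Exports.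

Local Open Scope classical_set_scope.
Local Open Scope ring_scope.

(** * Comparison of measures and integrals up to null sets *)

Section AlmostEverywhere.
Context {R : realType} {d : measure_display} {T : measurableType d}.

Lemma ae_subset_le_measure (mu : measure T R) (A B : set T) :
  measurable A -> measurable B -> {ae mu, forall w, A w -> B w} ->
  (mu A <= mu B)%E.
Proof.
move=> mA mB [N [mN N0 sub]].
(* Adding the null set [N] to [B] leaves its measure unchanged and absorbs the exceptional points of
   [A]. *)
rewrite -(measureU0 mB mN N0); apply: le_measure; rewrite ?inE //.
  exact: measurableU.
move=> w Aw; have [Bw|nBw] := pselect (B w); first by left.
by right; apply: sub => /= /(_ Aw).
Qed.

(** Since [f - h] is nonnegative almost everywhere, the integral of [f] is that of [h] plus that of
    [|f - h|]. Cancelling the finite integral of [h] forces [|f - h|] to integrate to 0, hence to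
    vanish almost everywhere. *)
Lemma ae_eq_of_le_integral_le (mu : measure T R) (D : set T) (f h : T -> R) :
  measurable D -> measurable_fun D f -> measurable_fun D h ->
  (forall w, D w -> 0 <= h w) -> (forall w, D w -> 0 <= f w) ->
  {ae mu, forall w, D w -> h w <= f w} ->
  (\int[mu]_(w in D) (h w)%:E < +oo)%E ->
  (\int[mu]_(w in D) (f w)%:E <= \int[mu]_(w in D) (h w)%:E)%E ->
  {ae mu, forall w, D w -> f w = h w}.
Proof.
move=> mD mf mh h0 f0 hf hfin fh.
pose r : T -> R := f \- h.
have mr : measurable_fun D (EFin \o r).
  by apply/measurable_EFinP; exact: measurable_funB.
have mEh : measurable_fun D (EFin \o h) by exact/measurable_EFinP.
have mEf : measurable_fun D (EFin \o f) by exact/measurable_EFinP.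
have mabs : measurable_fun D (abse \o (EFin \o r)) by exact: measurableT_comp.
have Ef : (\int[mu]_(w in D) (f w)%:E =
    \int[mu]_(w in D) (h w)%:E + \int[mu]_(w in D) `|(r w)%:E|)%E.
  rewrite -ge0_integralD //; apply: ge0_ae_eq_integral => //.
    - exact: emeasurable_funD.
    - by move=> w Dw; rewrite adde_ge0 // lee_fin h0.
  apply: filterS hf => w hfw Dw /=.
  by rewrite ger0_norm ?subr_ge0 ?hfw // -EFinD addrC subrK.
have abs0 : (\int[mu]_(w in D) `|(r w)%:E| = 0)%E.
  apply/eqP; rewrite eq_le integral_ge0 // andbT.
  have hfn : (\int[mu]_(w in D) (h w)%:E)%E \is a fin_num.
    by rewrite ge0_fin_numE // integral_ge0.
  by move: fh; rewrite Ef -leeBrDl // subee.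
have /(ae_eq_integral_abs mu mD mr) := abs0.
apply: filterS => w /[apply] -[] /eqP.
by rewrite subr_eq0 => /eqP.
Qed.

End AlmostEverywhere.

(** * The support, the violation event and the slack of a fixed point *)

Section HingeLoss.
Context {R : realType} {n m : nat} {d : measure_display}
  {Omega : measurableType d} (P : probability Omega R)
  (xi : {RV P >-> borel_cV R m}) (X : set 'cV[R]_n)
  (g : 'cV[R]_n -> borel_cV R m -> R) (c : 'cV[R]_n).

(** The support is closed: its complement is the union of all open sets of probability zero. *)
Lemma measurable_supp : measurable (supp xi).
Proof.
rewrite -[supp xi]setCK; apply: measurableC; apply: sub_sigma_algebra.
rewrite (_ : ~` supp xi =
  \bigcup_(U in [set U : set 'cV[R]_m | open U /\ P (xi @^-1` U) = 0%E]) U).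
  by apply: bigcup_open => U [].
apply/seteqP; split=> z /=.
  move=> /existsNP[U] /not_implyP[oU] /not_implyP[Uz] /negP.
  rewrite -leNgt => PU; exists U => //; split=> //.
  by apply/eqP; rewrite eq_le PU measure_ge0.
by move=> [U [oU PU] Uz] /(_ U oU Uz); rewrite PU ltxx.
Qed.

Lemma measurable_preimage_supp : measurable (xi @^-1` supp xi).
Proof. by apply: measurable_funPTI; exact: measurable_supp. Qed.

Lemma measurable_fun_comp_supp (h : borel_cV R m -> R) :
  measurable_fun (supp xi) h ->
  measurable_fun (xi @^-1` supp xi) (fun w => h (xi w)).
Proof.
move=> mh; apply: (measurable_comp (F := supp xi)) => //.
- exact: measurable_supp.
- by move=> _ [w Dw <-].
- exact: measurable_funTS.
Qed.

Lemma measurable_supp_event (h : borel_cV R m -> R) (Y : set R) :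
  measurable_fun (supp xi) h -> measurable Y ->
  measurable [set w | supp xi (xi w) /\ Y (h (xi w))].
Proof.
move=> mh mY; have mhxi := measurable_fun_comp_supp h mh.
by have := mhxi measurable_preimage_supp Y mY; apply.
Qed.

Definition violation (x : 'cV[R]_n) : set (borel_cV R m) :=
  supp xi `&` [set z | 0 < g x z].

Lemma measurable_violation x :
  measurable_fun (supp xi) (g x) -> measurable (violation x).
Proof.
move=> mg; rewrite (_ : violation x = supp xi `&` g x @^-1` `]0, +oo[).
  exact: mg measurable_supp _ _.
by apply/seteqP; split=> z [sz] /=; rewrite ?in_itv /= ?andbT.
Qed.

Lemma measurable_preimage_violation x :
  measurable_fun (supp xi) (g x) -> measurable (xi @^-1` violation x).
Proof. by move=> mg; apply: measurable_funPTI; exact: measurable_violation. Qed.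

Lemma measurable_satisfaction x : measurable_fun (supp xi) (g x) ->
  measurable [set w | supp xi (xi w) /\ [set z | g x z <= 0] (xi w)].
Proof.
move=> mg; rewrite (_ : [set w | _] =
    [set w | supp xi (xi w) /\ `]-oo, 0]%classic (g x (xi w))]).
  exact: measurable_supp_event.
by apply/seteqP; split=> w /=; rewrite in_itv.
Qed.

(** Satisfaction and violation partition the event that [xi] lies in its support. The first term is
    the same for every [x], so comparing satisfaction probabilities amounts to comparing violation
    probabilities. *)
Lemma prob_supp_violation x : measurable_fun (supp xi) (g x) ->
  (prob_supp xi [set z | (g x z <= 0)%R] =
   P (xi @^-1` supp xi) - P (xi @^-1` violation x))%E.
Proof.
move=> mg; have mD := measurable_preimage_supp.
have mV : measurable (xi @^-1` violation x).
  exact: measurable_preimage_violation.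
have VD : xi @^-1` violation x `<=` xi @^-1` supp xi by move=> w [].
(* [measureD] subtracts the measure of an intersection, so the violation event is first written as
   its intersection with the support event. *)
rewrite -[in RHS](setIidr VD) -measureD //; last first.
  by rewrite ltey_eq fin_num_measure.
congr (P _); apply/seteqP; split=> w /= [sw].
  by rewrite leNgt => /negP gw; split=> // -[].
by move=> gw; split=> //; rewrite leNgt; apply/negP => gw'; exact: gw.
Qed.

Definition least_slack (M : R) (x : 'cV[R]_n) (z : borel_cV R m) : R :=
  M * \1_(violation x) z.

Lemma measurable_least_slack (M : R) x :
  measurable_fun (supp xi) (g x) ->
  measurable_fun (supp xi) (least_slack M x).
Proof.
move=> mg; apply: measurable_funM => //.
by apply: measurable_funTS; apply/measurable_indicP; exact: measurable_violation.
Qed.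

Lemma expect_least_slack (M : R) x : 0 <= M -> measurable_fun (supp xi) (g x) ->
  expect_supp xi (least_slack M x) = (M%:E * P (xi @^-1` violation x))%E.
Proof.
move=> M0 mg; have mD := measurable_preimage_supp.
have mV : measurable (xi @^-1` violation x).
  exact: measurable_preimage_violation.
rewrite /expect_supp /least_slack.
under eq_integral do rewrite EFinM.
rewrite ge0_integralZl //.
- have := integral_indic P mD mV.
  rewrite setIidl; last by move=> w [].
  by move=> <-; congr (_ * _)%E; apply: eq_integral => w _.
- apply/measurable_EFinP; apply: measurable_fun_comp_supp.
  apply: measurable_funTS; apply/measurable_indicP.
  exact: measurable_violation.
Qed.

(** * Hinge-loss optima when positive values of [g x] equal [M] *)

Section TwoValued.
Context (M : R) (hmeas : forall x, X x -> measurable_fun (supp xi) (g x))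
  (hM : 0 < M)
  (hg : forall x z, X x -> supp xi z -> g x z <= 0 \/ g x z = M).

Lemma le_least_slack x z : X x -> supp xi z -> g x z <= least_slack M x z.
Proof.
move=> Xx sz; rewrite /least_slack indicE.
have [gz|gz] := hg x z Xx sz.
  by rewrite (le_trans gz) // mulr_ge0 // ltW.
by rewrite mem_set ?gz ?mulr1 //; split=> //=; rewrite gz.
Qed.

Lemma hinge_feasible_least_slack t x : X x -> dotp c x <= t ->
  hinge_feasible xi X g c t x (least_slack M x).
Proof.
move=> Xx xt; split=> //.
- by apply: measurable_least_slack; exact: hmeas.
- by move=> z _; rewrite mulr_ge0 // ltW.
- by apply: aeW => w sw; exact: le_least_slack.
Qed.

Lemma hinge_optimal_le_violation t x s y :
  hinge_optimal xi X g c t x s -> X y -> dotp c y <= t ->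
  (expect_supp xi s <= M%:E * P (xi @^-1` violation y))%E.
Proof.
move=> [_ opt] Xy yt; rewrite -expect_least_slack ?(ltW hM)//; last exact: hmeas.
by apply: opt; exact: hinge_feasible_least_slack.
Qed.

(** On the violation event [g x] can only be [M], so almost surely [s] is at least [M] there;
    elsewhere nonnegativity of [s] suffices. *)
Lemma hinge_feasible_least_slack_le t x s : hinge_feasible xi X g c t x s ->
  {ae P, forall w, (xi @^-1` supp xi) w ->
                   least_slack M x (xi w) <= s (xi w)}.
Proof.
move=> [Xx _ s0 gs _]; apply: filterS gs => w gs sw.
rewrite /least_slack indicE.
case: (boolP (xi w \in violation x)) => [|_]; last by rewrite mulr0 s0.
rewrite inE => -[_ /= gpos]; rewrite mulr1.
have [|<-] := hg x (xi w) Xx sw; last exact: gs.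
by rewrite leNgt gpos.
Qed.

Lemma expect_least_slack_le t x s : hinge_feasible xi X g c t x s ->
  (expect_supp xi (least_slack M x) <= expect_supp xi s)%E.
Proof.
move=> feas; have [Xx ms s0 _ _] := feas.
rewrite /expect_supp; apply: ae_ge0_le_integral.
- exact: measurable_preimage_supp.
- by move=> w _; rewrite lee_fin mulr_ge0 // ltW.
- apply/measurable_EFinP; apply: measurable_fun_comp_supp.
  by apply: measurable_least_slack; exact: hmeas.
- by move=> w sw; rewrite lee_fin s0.
- by apply/measurable_EFinP; exact: measurable_fun_comp_supp.
- exact: hinge_feasible_least_slack_le t x s feas.
Qed.

(** The least slack of [x] lies almost surely below [s] and is itself feasible, so optimality makes
    the two expectations equal; they are finite because [P] is a probability. *)
Lemma hinge_optimal_ae_eq t x s : hinge_optimal xi X g c t x s ->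
  {ae P, forall w, (xi @^-1` supp xi) w -> s (xi w) = least_slack M x (xi w)}.
Proof.
move=> opt; have [feas min_s] := opt; have [Xx ms s0 _ xt] := feas.
have mD := measurable_preimage_supp.
apply: (@ae_eq_of_le_integral_le _ _ _ P _ (s \o xi) (least_slack M x \o xi)).
- exact: mD.
- exact: measurable_fun_comp_supp.
- apply: measurable_fun_comp_supp.
  by apply: measurable_least_slack; exact: hmeas.
- by move=> w _ /=; rewrite mulr_ge0 // ltW.
- by move=> w sw /=; rewrite s0.
- exact: hinge_feasible_least_slack_le t x s feas.
- have := expect_least_slack M x (ltW hM) (hmeas x Xx).
  rewrite /expect_supp => ->; rewrite ltey_eq fin_numM // fin_num_measure //.
  by apply: measurable_preimage_violation; exact: hmeas.
- by apply: min_s; exact: hinge_feasible_least_slack.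
Qed.

(** The point [x] of an optimal pair violates with the least probability among the points within
    budget [t], and its slack [s] vanishes almost surely wherever [g x] is nonpositive. *)
Lemma prob_supp_hinge_optimal t x s y :
  hinge_optimal xi X g c t x s -> X y -> dotp c y <= t ->
  (prob_supp xi [set z | (g y z <= 0)%R] <=
   prob_supp xi [set z | s z = 0%R])%E.
Proof.
move=> opt Xy yt; have [feas _] := opt; have [Xx ms _ _ _] := feas.
have viol_le : (P (xi @^-1` violation x) <= P (xi @^-1` violation y))%E.
  (* Scaling by [M > 0] turns the violation probabilities into expectations of least slacks, with
     the expectation of [s] in between. *)
  rewrite -(@lee_pmul2l _ M%:E) ?lte_fin //.
  rewrite -expect_least_slack ?(ltW hM) //; last exact: hmeas.
  apply: le_trans (expect_least_slack_le t x s feas) _.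
  exact: hinge_optimal_le_violation t x s y opt Xy yt.
apply: (@le_trans _ _ (prob_supp xi [set z | (g x z <= 0)%R])).
  by rewrite !prob_supp_violation ?leeB //; exact: hmeas.
apply: ae_subset_le_measure.
- by apply: measurable_satisfaction; exact: hmeas.
- exact: (measurable_supp_event s [set 0]).
- apply: filterS (hinge_optimal_ae_eq t x s opt) => w sE [sw /= gw].
  split=> //=; rewrite sE // /least_slack indicE memNset ?mulr0 //.
  by move=> [_] /=; rewrite ltNge gw.
Qed.

Lemma prob_supp_hinge_feasible t x s : hinge_feasible xi X g c t x s ->
  (prob_supp xi [set z | s z = 0%R] <=
   prob_supp xi [set z | (g x z <= 0)%R])%E.
Proof.
move=> [Xx ms _ gs _]; apply: ae_subset_le_measure.
- exact: (measurable_supp_event s [set 0]).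
- by apply: measurable_satisfaction; exact: hmeas.
- by apply: filterS gs => w gs [sw /= s0]; split=> //=; rewrite -s0 gs.
Qed.

End TwoValued.
End HingeLoss.

(** * Equality of the two optimal values *)

Theorem theorem3 (R : realType) (n m : nat)
  (d : measure_display) (Omega : measurableType d)
  (P : probability Omega R) (xi : {RV P >-> borel_cV R m})
  (X : set 'cV[R]_n) (g : 'cV[R]_n -> borel_cV R m -> R)
  (c : 'cV[R]_n) (eps M : R)
  (heps : 0 < eps < 1)
  (hmeas : forall x, X x -> measurable_fun (supp xi) (g x))
  (hopt : exists v, is_ccp_value xi X g c eps v)
  (hatt : hinge_attained xi X g c)
  (hM : 0 < M)
  (hg : forall x z, X x -> supp xi z -> g x z <= 0 \/ g x z = M) :
  exists vA vstar : R,
    [/\ is_alsox_value xi X g c eps vA,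
        is_ccp_value xi X g c eps vstar &
        vA = vstar].
Proof.
have [v vopt] := hopt; exists v, v; split=> //.
(* A minimizer [x] of the chance constrained program has cost exactly [v], so it serves as the
   comparison point at threshold [v]. *)
have [[x [Xx px] <-] lbv] := vopt; split.
  split; first by exists x.
  move=> y s opt; apply: le_trans px _.
  exact: (prob_supp_hinge_optimal P xi X g c M hmeas hM hg _ _ _ _ opt).
move=> t [[y [Xy yt]] tP].
(* The ALSO-X test quantifies over all optimal pairs; attainment supplies one, whose point [z] is
   chance-feasible with cost at most [t], whence [v <= t]. *)
have [|z [s opt]] := hatt t.
  exists y, (least_slack P xi g M y).
  exact: (hinge_feasible_least_slack P xi X g c M hmeas hM hg).
have [feas _] := opt; have [Xz _ _ _ zt] := feas.
apply: le_trans zt; apply: lbv; exists z => //; split=> //.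
apply: le_trans (tP _ _ opt) _.
exact: (prob_supp_hinge_feasible P xi X g c hmeas _ _ _ feas).
Qed.
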